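(* There exist constants $\alpha,\beta>0$ such that for all integers $k>r\ge 0$ with $k\ge \alpha r+\beta$, every oriented path of length $k$ containing exactly $r$ direction flips is tournament anti-Sidorenko. In particular, one can take $\alpha=1665$ and $\beta=1454$; that is, for all integers $k>r\ge 0$ with $k\ge 1665r+1454$, every oriented path of length $k$ with exactly $r$ direction flips is tournament anti-Sidorenko.
   Context: An oriented graph $H=(V(H),E(H))$ has a finite vertex set and a set $E(H)\subseteq V(H)\times V(H)$ of directed edges, with no loops and at most one directed edge between each pair of distinct vertices. A tournament is an oriented complete graph (exactly one directed edge between each pair of distinct vertices); tournaments are finite and nonempty. A homomorphism from an oriented graph $H$ to a tournament $T$ is a map $f:V(H)\to V(T)$ such that $(f(u),f(v))\in E(T)$ for every $(u,v)\in E(H)$. The homomorphism density is $t(H,T)=\frac{|\mathrm{Hom}(H,T)|}{|V(T)|^{|V(H)|}}$, where $\mathrm{Hom}(H,T)$ is the set of homomorphisms. $H$ is tournament anti-Sidorenko if $t(H,T)\le (1/2)^{|E(H)|}$ for every tournament $T$. An oriented path of length $k$ is $P_k(\vec x)$ for some $\vec x=(x_1,\dots,x_k)\in\{-1,1\}^k$: its vertices are $v_0,\dots,v_k$, and for each $1\le i\le k$ it has the edge $(v_{i-1},v_i)$ if $x_i=1$ and the edge $(v_i,v_{i-1})$ if $x_i=-1$. A direction flip is an internal vertex $v_i$ ($1\le i\le k-1$) with $x_ix_{i+1}=-1$ (equivalently, a non-leaf source or sink). *)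

(* Defs.v *)
From HB Require Import structures.
From mathcomp Require Import all_boot all_order all_algebra.
From mathcomp Require Import reals.

Set Implicit Arguments.
Unset Strict Implicit.
Unset Printing Implicit Defensive.

Import Order.TTheory GRing.Theory Num.Theory.
Local Open Scope ring_scope.

Record oriented_graph := OrientedGraph {
  vertex : finType;
  edges : {set vertex * vertex};
  edges_loopless : forall u, (u, u) \notin edges;
  edges_oriented : forall u v, u != v -> ~~ (((u, v) \in edges) && ((v, u) \in edges))
}.

Definition is_tournament (T : oriented_graph) : Prop :=
  (0 < #|vertex T|)%N /\
  forall u v : vertex T, u != v ->
    ((u, v) \in edges T) (+) ((v, u) \in edges T).

Definition Hom (H T : oriented_graph) : {set {ffun vertex H -> vertex T}} :=
  [set f : {ffun vertex H -> vertex T} |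
    [forall u, forall v, ((u, v) \in edges H) ==> ((f u, f v) \in edges T)]].

Definition hom_density (H T : oriented_graph) : rat :=
  #|Hom H T|%:R / #|vertex T|%:R ^+ #|vertex H|.

Definition anti_sidorenko (H : oriented_graph) : Prop :=
  forall T : oriented_graph, is_tournament T ->
    hom_density H T <= (1 / 2) ^+ #|edges H|.

Definition is_sign_vector (k : nat) (x : k.-tuple int) : Prop :=
  forall i : 'I_k, tnth x i = 1 \/ tnth x i = -1.

(* Tuples are indexed from 0, so the sign x_i of the step from v_(i-1) to v_i
   is [tnth x] at index i - 1; the vertex v_i is the ordinal i of 'I_k.+1. *)
Definition path_edges (k : nat) (x : k.-tuple int) : {set 'I_k.+1 * 'I_k.+1} :=
  [set e : 'I_k.+1 * 'I_k.+1 | [exists i : 'I_k,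
     [&& tnth x i == 1, e.1 == i :> nat & e.2 == i.+1 :> nat]
  || [&& tnth x i == -1, e.1 == i.+1 :> nat & e.2 == i :> nat]]].

Lemma path_edges_loopless (k : nat) (x : k.-tuple int) (u : 'I_k.+1) :
  (u, u) \notin path_edges x.
Proof.
rewrite inE; apply/existsP => -[i /=].
case/orP => /and3P[_ /eqP ui /eqP].
  by rewrite ui => /eqP; rewrite ltn_eqF.
by rewrite ui => /eqP; rewrite gtn_eqF.
Qed.

Lemma path_edges_oriented (k : nat) (x : k.-tuple int) (u v : 'I_k.+1) :
  u != v -> ~~ (((u, v) \in path_edges x) && ((v, u) \in path_edges x)).
Proof.
move=> _; rewrite !inE; apply/andP => -[/existsP[i /= Hi] /existsP[j /= Hj]].
case/orP: Hi => /and3P[/eqP xi /eqP ui /eqP vi];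
  case/orP: Hj => /and3P[/eqP xj /eqP vj /eqP uj].
- have : (u < v)%N by rewrite ui vi.
  by rewrite uj vj ltnNge leqnSn.
- have ij : i = j by apply: val_inj; rewrite /= -ui -uj.
  by move: xi; rewrite ij xj.
- have ij : i = j by apply: val_inj; rewrite /= -vi -vj.
  by move: xi; rewrite ij xj.
have : (v < u)%N by rewrite ui vi.
by rewrite uj vj ltnNge leqnSn.
Qed.

Definition oriented_path (k : nat) (x : k.-tuple int) : oriented_graph :=
  OrientedGraph (@path_edges_loopless k x) (@path_edges_oriented k x).

(* With 0-based indexing, x_i * x_(i+1) reads x`_(i.-1) * x`_i; the condition
   0 < i < k keeps both indices within the tuple. *)
Definition direction_flips (k : nat) (x : k.-tuple int) : {set 'I_k.+1} :=
  [set i : 'I_k.+1 | (0 < i < k)%N && (x`_(i.-1) * x`_i == -1)].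

(* Main.v *)
Require Import Defs.
From mathcomp Require Import all_boot all_order all_algebra.
From mathcomp Require Import reals.
From mathcomp Require Import ring lra zify.

(** Let A be the adjacency matrix of a tournament on a vertex set V of size n,
    and sigma u v = A u v - A v u, a skew kernel with values in {-1, 0, 1}.
    Entrywise A is at most (1 + sigma) / 2 and its transpose at most
    (1 - sigma) / 2, so the density of a path with signs y_1, ..., y_k is at
    most 2^-k times the mean of F_1, where F_(k+1) = 1 and
    F_j = mean(F_(j+1)) + y_j S F_(j+1), with S the skew operator of kernel
    sigma / n.  It suffices that this mean is at most 1.

    Write h = S 1 and s = |h|^2, which measures how far the tournament is from
    being regular.  On a directed stretch the mean loses about a factor 1 - s
    at each step, while a flip gains at most a factor 1 + O(s); hence long
    stretches pay for the flips, uniformly in s.  The mean alone is not monotone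
    (immediately after a flip it can grow), so the argument follows the quadratic
    energy
       E_y(f) = |f|^2 - 2 y mean(f) <h, f>,
    which satisfies, for y = 1 or -1,
       E_y(mean(f) + y S f) <= (1 - s / 4) E_y(f)         ([energy_step]),
       E_y(mean(f) + y S f) <= (1 + 8 s) E_(-y)(f)        ([energy_flip]),
       (1 - s) mean(f)^2 <= E_y(f)                        ([mean_le_energy]).
    Since (1 - s / 4)^32 (1 + 8 s) <= 1 and (1 - s / 4)^8 <= 1 - s, the mean is
    at most 1 as soon as k >= 33 r + 8, where r counts the flips.

    The spectral input is that S has small norm, quantitatively the inequality
    [skew_plane_bound]: the Hilbert-Schmidt norm of S is at most 1, and the part
    of a skew operator seen on two orthonormal vectors is counted twice in that
    norm. *)
Import Order.TTheory GRing.Theory Num.Theory.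
Local Open Scope ring_scope.

(** * Averaged inner product *)

(** {ffun I -> R} is a module over R only through the regular module R^o;
    scaling by hand keeps every coefficient in R itself. *)
Definition fscale {R : realFieldType} {I : finType} (c : R) (f : {ffun I -> R})
  : {ffun I -> R} := [ffun i => c * f i].
Local Notation "c *^ f" := (fscale c f) (at level 40).

Section Dot.
Context {R : realFieldType} {I : finType}.
Implicit Types f g : {ffun I -> R}.

Definition dot f g : R := (\sum_i f i * g i) / #|I|%:R.

Lemma dotC f g : dot f g = dot g f.
Proof. by congr (_ / _); apply: eq_bigr => i _; rewrite mulrC. Qed.

Lemma dotDl f1 f2 g : dot (f1 + f2) g = dot f1 g + dot f2 g.
Proof.
rewrite /dot -mulrDl -big_split /=; congr (_ / _).
by apply: eq_bigr => i _; rewrite ffunE mulrDl.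
Qed.

Lemma dotZl c f g : dot (c *^ f) g = c * dot f g.
Proof.
rewrite /dot mulrA mulr_sumr; congr (_ / _).
by apply: eq_bigr => i _; rewrite ffunE mulrA.
Qed.

Lemma dotBl f1 f2 g : dot (f1 - f2) g = dot f1 g - dot f2 g.
Proof.
rewrite (_ : f1 - f2 = f1 + (-1) *^ f2); last first.
  by apply/ffunP => i; rewrite !ffunE mulN1r.
by rewrite dotDl dotZl mulN1r.
Qed.

Lemma dotDr f g1 g2 : dot f (g1 + g2) = dot f g1 + dot f g2.
Proof. by rewrite dotC dotDl !(dotC f). Qed.

Lemma dotZr c f g : dot f (c *^ g) = c * dot f g.
Proof. by rewrite dotC dotZl (dotC f). Qed.

Lemma dotBr f g1 g2 : dot f (g1 - g2) = dot f g1 - dot f g2.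
Proof. by rewrite dotC dotBl !(dotC f). Qed.

Lemma dot_ge0 f : 0 <= dot f f.
Proof.
by rewrite divr_ge0 ?ler0n // sumr_ge0 // => i _; rewrite -expr2 sqr_ge0.
Qed.

Lemma dot_eq0 f : (0 < #|I|)%N -> dot f f = 0 -> f = 0.
Proof.
move=> I_gt0 /eqP; rewrite mulf_eq0 invr_eq0 pnatr_eq0 gtn_eqF // orbF.
rewrite psumr_eq0 => [/allP f0|i _]; last by rewrite -expr2 sqr_ge0.
apply/ffunP => i; rewrite ffunE; apply/eqP.
by have := f0 i (mem_index_enum i); rewrite -expr2 sqrf_eq0.
Qed.

End Dot.

Definition dotE {R : realFieldType} {I : finType} :=
  (@dotBl R I, @dotBr R I, @dotDl R I, @dotDr R I, @dotZl R I, @dotZr R I).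

(** * Wedge products *)

Section Wedge.
Context {R : realFieldType} {V : finType}.
Implicit Types f g h k : {ffun V -> R}.

Definition wedge f g : {ffun V * V -> R} :=
  [ffun z => f z.1 * g z.2 - g z.1 * f z.2].

Lemma dot_tensor f1 g1 f2 g2 :
  dot [ffun z : V * V => f1 z.1 * g1 z.2] [ffun z => f2 z.1 * g2 z.2]
  = dot f1 f2 * dot g1 g2.
Proof.
rewrite /dot card_prod natrM invfM mulrACA; congr (_ * _).
rewrite big_distrlr pair_big /=; apply: eq_bigr => z _.
by rewrite !ffunE mulrACA.
Qed.

Lemma dot_wedge f g h k :
  dot (wedge f g) (wedge h k) = 2 * (dot f h * dot g k - dot f k * dot g h).
Proof.
have wE f' g' : wedge f' g' =
    [ffun z : V * V => f' z.1 * g' z.2] - [ffun z => g' z.1 * f' z.2].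
  by apply/ffunP => z; rewrite !ffunE.
by rewrite !wE !dotE !dot_tensor; ring.
Qed.

(** The defect in the Cauchy-Schwarz inequality is half the squared norm of the
    wedge product. *)
Lemma dot_cauchy_schwarz f g : dot f g ^+ 2 <= dot f f * dot g g.
Proof. by have := dot_ge0 (wedge f g); rewrite dot_wedge (dotC g f); lra. Qed.

End Wedge.

(** * Skew kernels with entries of modulus at most 1 *)

Section SkewKernel.
Context {R : realFieldType} {V : finType}.
Variable sigma : V -> V -> R.
Hypothesis sigmaN : forall u v, sigma v u = - sigma u v.
Hypothesis sigma_le1 : forall u v, sigma u v ^+ 2 <= 1.
Hypothesis V_gt0 : (0 < #|V|)%N.
Implicit Types f g e : {ffun V -> R}.

Definition skew_op f : {ffun V -> R} :=
  [ffun u => (\sum_v sigma u v * f v) / #|V|%:R].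
Local Notation S := skew_op.

Lemma skew_opD f g : S (f + g) = S f + S g.
Proof.
apply/ffunP => u; rewrite !ffunE -mulrDl -big_split /=; congr (_ / _).
by apply: eq_bigr => v _; rewrite ffunE mulrDr.
Qed.

Lemma skew_opZ c f : S (c *^ f) = c *^ S f.
Proof.
apply/ffunP => u; rewrite !ffunE mulrA mulr_sumr.
by congr (_ / _); apply: eq_bigr => v _; rewrite ffunE mulrCA.
Qed.

Lemma dot_skew_op f g : dot f (S g) = - dot (S f) g.
Proof.
rewrite /dot -mulNr; congr (_ / _).
under eq_bigr do rewrite ffunE mulrA mulr_sumr mulr_suml.
rewrite exchange_big /= -sumrN; apply: eq_bigr => v _.
rewrite ffunE mulr_suml mulr_suml -sumrN; apply: eq_bigr => u _.
by rewrite (sigmaN v u); ring.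
Qed.

Lemma dot_skew_op_self f : dot f (S f) = 0.
Proof. by have := dot_skew_op f f; rewrite (dotC (S f)); lra. Qed.

Definition kernel : {ffun V * V -> R} := [ffun z => sigma z.1 z.2].

Lemma dot_kernel_le1 : dot kernel kernel <= 1.
Proof.
have n_gt0 : 0 < #|{: V * V}|%:R :> R by rewrite ltr0n card_prod muln_gt0 V_gt0.
rewrite ler_pdivrMr // mul1r -sumr_const ler_sum // => z _.
by rewrite ffunE -expr2.
Qed.

Lemma dot_kernel_wedge f g : dot kernel (wedge f g) = 2 * dot f (S g).
Proof.
have tE f' g' : dot kernel [ffun z : V * V => f' z.1 * g' z.2] = dot f' (S g').
  rewrite /dot card_prod natrM invfM mulrA; congr (_ / _).
  rewrite (eq_bigr (fun z => sigma z.1 z.2 * (f' z.1 * g' z.2))) => [|z _];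
    last by rewrite !ffunE.
  rewrite -(pair_bigA _ (fun u v => sigma u v * (f' u * g' v))) /= mulr_suml.
  apply: eq_bigr => u _; rewrite ffunE mulrA mulr_sumr; congr (_ / _).
  by apply: eq_bigr => v _ /=; ring.
have -> : wedge f g =
    [ffun z : V * V => f z.1 * g z.2] - [ffun z => g z.1 * f z.2].
  by apply/ffunP => z; rewrite !ffunE.
by rewrite dotBr !tE (dot_skew_op g f) (dotC (S g)); ring.
Qed.

(** With k the component of [S g] orthogonal to e, this is Bessel's inequality
    for the kernel against the wedges of [S e] with e and of k with g.  The
    wedges are orthogonal to each other because e is orthogonal to g and to k,
    and skewness makes [S e] orthogonal to e and k orthogonal to g. *)
Lemma skew_plane_bound e g : dot e e = 1 -> dot e g = 0 ->
  dot g g * dot (S e) (S e) + (dot (S g) (S g) - dot (S e) g ^+ 2)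
  <= dot g g / 2.
Proof.
move=> ee eg.
have [G0|G_neq0] := eqVneq (dot g g) 0.
  have -> : g = 0 by apply: dot_eq0.
  have -> : 0 = 0 *^ 0 :> {ffun V -> R}
    by apply/ffunP => u; rewrite !ffunE mul0r.
  by rewrite skew_opZ !dotE; lra.
have G_gt0 : 0 < dot g g by rewrite lt0r G_neq0 dot_ge0.
set G := dot g g; set h := S e; set k := S g - dot e (S g) *^ e.
have he : dot h e = 0 by rewrite dotC dot_skew_op_self.
have ke : dot k e = 0.
  by rewrite /k !dotE ee (dotC (S g) e); ring.
have kg : dot k g = 0.
  by rewrite /k !dotE eg dotC dot_skew_op_self; ring.
have kSg : dot k (S g) = dot (S g) (S g) - dot h g ^+ 2.
  by rewrite /k !dotE (dot_skew_op e g) -/h; ring.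
have kk : dot k k = dot (S g) (S g) - dot h g ^+ 2.
  by rewrite {2}/k dotBr dotZr ke kSg; ring.
(* The kernel minus its projections onto the two wedges, cleared of the
   denominator G. *)
have := dot_ge0 (G *^ kernel - G *^ wedge h e - wedge k g).
rewrite !dotE !(dotC (wedge _ _) kernel) !dot_kernel_wedge !dot_wedge.
rewrite (dotC e h) (dotC g e) (dotC g k) (dotC e k) he ke kg eg ee kSg kk.
rewrite -/h -/G.
set c := _ - dot h g ^+ 2; set s := dot h h; have := dot_kernel_le1.
set t := dot kernel kernel => t1 H.
have : 0 <= G * (G / 2 - (G * s + c)).
  have : G ^+ 2 * t <= G ^+ 2 by rewrite ler_piMr ?sqr_ge0.
  by move: H; lra.
by rewrite pmulr_rge0 // subr_ge0.
Qed.


(** * Energy of one step *)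

Definition one : {ffun V -> R} := [ffun=> 1].
(** [S one] is the normalised difference of the out-degree and the in-degree when
    the kernel comes from a tournament, so its squared norm vanishes exactly on
    regular tournaments. *)
Definition irregularity : R := dot (S one) (S one).
Local Notation h := (S one).
Local Notation s := irregularity.

Lemma dot_one_one : dot one one = 1.
Proof.
rewrite /dot (eq_bigr (fun=> 1)) => [|i _]; last by rewrite ffunE mulr1.
by rewrite sumr_const divff // pnatr_eq0 -lt0n.
Qed.

Lemma irregularity_ge0 : 0 <= s. Proof. exact: dot_ge0. Qed.

Lemma irregularity_le_half : s <= 1 / 2.
Proof.
have := skew_plane_bound _ _ dot_one_one (dot_skew_op_self one).
have := dot_cauchy_schwarz one (S h).
rewrite dot_one_one (dot_skew_op one) -/s => H1 H2.
have := irregularity_ge0; rewrite le_eqVlt => /predU1P[<-|s_gt0]; first by lra.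
have : 0 <= s * (1 / 2 - s) by lra.
by rewrite (pmulr_rge0 _ s_gt0) subr_ge0.
Qed.

Definition step (y : R) f := dot one f *^ one + y *^ S f.

(** With g the mean-zero part of f, the weight 2 of the cross term is the one for
    which the terms in [dot one f * dot (S one) (S g)] cancel in the energy of
    [step y f]. *)
Definition energy (y : R) f := dot f f - 2 * y * (dot one f * dot h f).

(** For f = a + g with a its mean and g of mean 0, the parameters stand for
    p = <S 1, g>, q = <S 1, S g>, G = |g|^2 and c = |S g|^2 - p^2, which is the
    squared norm of the component of [S g] orthogonal to constants. *)
Definition coord_bounds (p q G c : R) :=
  [/\ 0 <= G, p ^+ 2 <= s * G, q ^+ 2 <= s * c & s * G + c <= G / 2].

(** The mean and four coordinates determine the energy before and after a step,
    which reduces the energy inequalities to real algebra. *)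
Lemma energy_coords f : exists p q G c : R, let a := dot one f in
  [/\ coord_bounds p q G c,
      forall y, energy y f = a ^+ 2 - 2 * y * (a * p) + G &
      forall y, y ^+ 2 = 1 -> energy y (step y f) =
        (1 - s) * (a ^+ 2 - 2 * y * (a * p)) + p ^+ 2 + c + 2 * y * (p * q)].
Proof.
set a := dot one f; pose g := f - a *^ one; pose p := dot h g.
pose k := S g + p *^ one.
have oh : dot one h = 0 by exact: dot_skew_op_self.
have ho : dot h one = 0 by rewrite dotC.
have og : dot one g = 0 by rewrite /g !dotE dot_one_one -/a; ring.
have oSg : dot one (S g) = - p by rewrite dot_skew_op.
have kk : dot k k = dot (S g) (S g) - p ^+ 2.
  by rewrite /k !dotE (dotC (S g) one) oSg dot_one_one; ring.
have hk : dot h k = dot h (S g) by rewrite /k !dotE ho; ring.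
have fE : f = a *^ one + g by apply/ffunP => u; rewrite !ffunE; ring.
clearbody g.
exists p, (dot h (S g)), (dot g g), (dot k k); split.
- split; rewrite ?dot_ge0 ?dot_cauchy_schwarz //.
    by rewrite -hk dot_cauchy_schwarz.
  by rewrite kk mulrC skew_plane_bound ?dot_one_one.
- move=> y; rewrite /energy -/a {1 2 3}fE !dotE (dotC g one) og ho dot_one_one.
  by rewrite -/p; ring.
move=> y y2; rewrite /energy /step -/a.
have SfE : S f = a *^ h + S g by rewrite {1}fE skew_opD skew_opZ.
rewrite SfE kk !dotE dot_one_one oh ho oSg.
rewrite (dotC (S g) one) oSg (dotC (S g) h) -/s.
by ring: y2.
Qed.

(** A quadratic form in (a, sqrt G) whose discriminant, after p is replaced by its
    bound sqrt (s G), is nonpositive. *)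
Lemma quadratic_form_ge0 (a p G t m w : R) :
  0 <= G -> p ^+ 2 <= s * G -> 0 < t -> 0 <= w -> m ^+ 2 <= t * w ->
  0 <= t * s * a ^+ 2 - 2 * m * (a * p) + w * G.
Proof.
move=> G_ge0 p_le t_gt0 w_ge0 m_le.
have := irregularity_ge0; rewrite le_eqVlt => /predU1P[s0|s_gt0].
  have /eqP : p ^+ 2 == 0
    by rewrite eq_le sqr_ge0 andbT (le_trans p_le) // -s0 mul0r.
  move/eqP; rewrite sqrf_eq0 => /eqP ->.
  by rewrite -s0 !mulr0 mul0r subr0 add0r mulr_ge0.
have tws : 0 <= t * w * (s * G - p ^+ 2).
  by rewrite mulr_ge0 ?subr_ge0 // mulr_ge0 // ltW.
have twp : 0 <= p ^+ 2 * (t * w - m ^+ 2)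
  by rewrite mulr_ge0 ?sqr_ge0 ?subr_ge0.
have := sqr_ge0 (t * s * a - m * p) => sq.
rewrite -(pmulr_rge0 _ (mulr_gt0 t_gt0 s_gt0)); lra.
Qed.

(** The part of the energy of a step that does not involve the mean of f: it is
    at most G / 2 up to O(s G), which is what makes the fluctuation g contract. *)
Lemma remainder_le p q G c z : coord_bounds p q G c -> z ^+ 2 = 1 ->
  p ^+ 2 + c + 2 * z * (p * q) <= (1 / 2 + 11 / 6 * s - 3 * s ^+ 2) * G.
Proof.
move=> [G_ge0 p_le q_le c_le] z2; have s_ge0 := irregularity_ge0.
(* The weights 1/3 and 3 balance the two bounds for s up to 1/2. *)
have cross : 2 * z * (p * q) <= p ^+ 2 / 3 + 3 * q ^+ 2.
  have := sqr_ge0 (p - 3 * z * q).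
  have -> : (p - 3 * z * q) ^+ 2 = p ^+ 2 - 6 * z * (p * q) + 9 * q ^+ 2.
    by ring: z2.
  lra.
have : (1 + 3 * s) * (s * G + c) <= (1 + 3 * s) * (G / 2).
  by rewrite ler_wpM2l // addr_ge0 // mulr_ge0.
lra.
Qed.

Lemma energy_step y f : y ^+ 2 = 1 ->
  energy y (step y f) <= (1 - s / 4) * energy y f.
Proof.
move=> y2; have [p [q [G [c [bnd eE sE]]]]] := energy_coords f.
rewrite eE sE //; set a := dot one f.
have rem := remainder_le _ _ _ _ _ bnd y2.
have [G_ge0 p_le _ _] := bnd.
have s_ge0 := irregularity_ge0; have s_le := irregularity_le_half.
have sq : 0 <= s * (a ^+ 2 - 2 * y * (a * p) + p ^+ 2).
  have -> : a ^+ 2 - 2 * y * (a * p) + p ^+ 2 = (a - y * p) ^+ 2 by ring: y2.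
  by rewrite mulr_ge0 ?sqr_ge0.
have sp : s * p ^+ 2 <= s * (s * G) by rewrite ler_wpM2l.
have gap : 0 <= (1 / 2 - 25 / 12 * s + 9 / 4 * s ^+ 2) * G.
  by rewrite mulr_ge0 //; have := sqr_ge0 (s - 25 / 54); lra.
lra.
Qed.

(** The cross term changes sign between [energy (- y)] and [energy y], a change of
    order sqrt s.  The contraction of the fluctuation in the same step absorbs it
    and leaves a loss of order s only. *)
Lemma energy_flip y f : y ^+ 2 = 1 ->
  energy y (step y f) <= (1 + 8 * s) * energy (- y) f.
Proof.
move=> y2; have [p [q [G [c [bnd eE sE]]]]] := energy_coords f.
rewrite !eE sE //; set a := dot one f.
have rem := remainder_le _ _ _ _ _ bnd y2.
have [G_ge0 p_le _ _] := bnd.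
have s_ge0 := irregularity_ge0; have s_le := irregularity_le_half.
have := quadratic_form_ge0 a p G 9 (- y * (2 + 7 * s)) (1 / 2 + 6 * s) G_ge0 p_le.
have s2_le : s ^+ 2 <= s / 2 by rewrite expr2; have := ler_wpM2l s_ge0 s_le; lra.
have m_le : (- y * (2 + 7 * s)) ^+ 2 <= 9 * (1 / 2 + 6 * s).
  by rewrite exprMn sqrrN y2; lra.
have w_ge0 : 0 <= 1 / 2 + 6 * s by lra.
move=> /(_ (ltr0n _ 9) w_ge0 m_le).
have : 0 <= (s / 6 + 3 * s ^+ 2) * G.
  by rewrite mulr_ge0 //; have := sqr_ge0 s; lra.
lra.
Qed.

Lemma mean_le_energy y f : y ^+ 2 = 1 ->
  (1 - s) * dot one f ^+ 2 <= energy y f.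
Proof.
move=> y2; have [p [q [G [c [[G_ge0 p_le _ _] eE _]]]]] := energy_coords f.
rewrite eE; have := quadratic_form_ge0 (dot one f) p G 1 y 1 G_ge0 p_le.
by rewrite y2 ltr01 ler01 mulr1 lexx => /(_ isT isT isT); lra.
Qed.

Lemma bernoulli_inv (x : R) j : 0 <= x <= 1 ->
  (1 - x) ^+ j * (1 + j%:R * x) <= 1.
Proof.
move=> /andP[x_ge0 x_le1]; elim: j => [|j IHj]; first by rewrite mul0r addr0 mulr1.
apply: le_trans IHj; rewrite exprSr -mulrA ler_wpM2l ?exprn_ge0 ?subr_ge0 //.
rewrite -natr1; have := sqr_ge0 x; have : 0 <= j%:R * x ^+ 2.
  by rewrite mulr_ge0 ?ler0n ?sqr_ge0.
lra.
Qed.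

(** * Energy along a path *)

Definition walk_density (xs : seq int) : {ffun V -> R} :=
  foldr (fun y f => step y%:~R f) one xs.

Definition sign_seq (xs : seq int) := all (fun y => (y == 1) || (y == -1)) xs.

Definition flips (xs : seq int) : nat :=
  \sum_(i < (size xs).-1) (xs`_i * xs`_i.+1 == -1)%R.

Lemma flips1 y : flips [:: y] = 0%N. Proof. by rewrite /flips big_ord0. Qed.

Lemma flips_cons y z xs :
  flips [:: y, z & xs] = ((y * z == -1)%R + flips (z :: xs))%N.
Proof. by rewrite /flips big_ord_recl. Qed.

(** Each flip is charged 33 steps: 32 to compensate the factor 1 + 8 s and one for
    the step at which it occurs. *)
Lemma energy_walk_density y xs : sign_seq (y :: xs) ->
  (1 - s / 4) ^+ (33 * flips (y :: xs)) * energy y%:~R (walk_density (y :: xs))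
  <= (1 - s / 4) ^+ (size xs).+1.
Proof.
have s_ge0 := irregularity_ge0; have s_le := irregularity_le_half.
set lam := 1 - s / 4; have lam_ge0 : 0 <= lam by rewrite /lam; lra.
have sq1 (z : int) : (z == 1) || (z == -1) -> z%:~R ^+ 2 = 1 :> R.
  by case/orP=> /eqP->; rewrite ?rmorphN ?sqrrN expr1n.
have [t [tE t_ge0 flip_cost]] : exists t,
    [/\ lam ^+ 33 = lam * t, 0 <= t & t * (1 + 8 * s) <= 1].
  exists (lam ^+ 32); rewrite exprS exprn_ge0 //; split=> //.
  have s4 : 0 <= s / 4 <= 1 by lra.
  by have := bernoulli_inv (s / 4) 32 s4; rewrite -/lam; lra.
elim: xs y => [|z xs IHxs] y /=.
  rewrite andbT => /sq1 y2; rewrite flips1 muln0 expr0 mul1r expr1.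
  apply: le_trans (energy_step _ _ y2) _.
  by rewrite /energy dot_one_one (dotC h one) dot_skew_op_self -/lam; lra.
case/andP=> ysgn zxs; have y2 := sq1 _ ysgn; have {IHxs} := IHxs z zxs.
rewrite flips_cons /=; set f := step _ _ => IHxs.
have [zy|zy] : z = y \/ z = - y.
  have /andP[zsgn _] := zxs.
  by case/orP: ysgn => /eqP->; case/orP: zsgn => /eqP->; [left|right|right|left].
- have -> : (y * z == -1) = false.
    by rewrite zy; case/orP: ysgn => /eqP->.
  rewrite add0n (exprS _ (size xs).+1).
  apply: le_trans (ler_wpM2l lam_ge0 IHxs).
  by rewrite mulrCA ler_wpM2l ?exprn_ge0 // zy energy_step.
have -> : (y * z == -1) = true.
  by rewrite zy; case/orP: ysgn => /eqP->.
rewrite mulnDr muln1 exprD (exprS _ (size xs).+1) tE.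
apply: le_trans (ler_wpM2l lam_ge0 IHxs).
rewrite -!mulrA ler_wpM2l // mulrCA ler_wpM2l ?exprn_ge0 //.
have E_ge0 : 0 <= energy z%:~R f.
  apply: le_trans (mean_le_energy _ f (sq1 _ _)).
    by rewrite mulr_ge0 ?sqr_ge0; lra.
  by case/andP: zxs.
apply: le_trans (_ : t * ((1 + 8 * s) * energy z%:~R f) <= _).
  by rewrite ler_wpM2l // zy rmorphN energy_flip.
by rewrite mulrA ler_piMl.
Qed.

Lemma mean_walk_density_le1 xs : sign_seq xs ->
  (33 * flips xs + 8 <= size xs)%N -> dot one (walk_density xs) <= 1.
Proof.
case: xs => [|y xs] sgn; first by rewrite leqn0 addn_eq0 andbF.
move=> len; have := energy_walk_density _ _ sgn.
have s_ge0 := irregularity_ge0; have s_le := irregularity_le_half.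
have y2 : y%:~R ^+ 2 = 1 :> R.
  by case/andP: sgn => /orP[]/eqP-> _; rewrite ?rmorphN ?sqrrN expr1n.
have := mean_le_energy _ (walk_density (y :: xs)) y2.
set lam := 1 - s / 4; set a := dot one _; set E := energy _ _ => aE Ele.
have lam_gt0 : 0 < lam by rewrite /lam; lra.
have lam_ge0 := ltW lam_gt0.
have lam_le1 : lam <= 1 by rewrite /lam; lra.
have lam8 : lam ^+ 8 <= 1 - s.
  have s4 : 0 <= s / 4 <= 1 by lra.
  have := bernoulli_inv (s / 4) 8 s4; rewrite -/lam => b8.
  have s12 : 1 <= (1 - s) * (1 + 2 * s).
    by have := ler_wpM2l s_ge0 s_le; lra.
  rewrite -(ler_pM2r (_ : 0 < 1 + 2 * s)); last by lra.
  by apply: (le_trans _ s12); lra.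
have a2 : lam ^+ (33 * flips (y :: xs) + 8) * a ^+ 2
          <= lam ^+ (33 * flips (y :: xs) + 8) * 1.
  rewrite mulr1; apply: le_trans (_ : lam ^+ (size xs).+1 <= _); last first.
    by rewrite ler_wiXn2l.
  apply: le_trans Ele; rewrite exprD -mulrA ler_wpM2l ?exprn_ge0 //.
  by apply: le_trans aE; rewrite ler_wpM2r ?sqr_ge0.
rewrite (ler_pM2l (exprn_gt0 _ lam_gt0)) in a2.
case: (lerP a 1) => // a_gt1; have : 1 * 1 < a * a by rewrite ltr_pM //; lra.
by rewrite mul1r -expr2 ltNge a2.
Qed.

End SkewKernel.

(** * Homomorphisms of paths as walks *)

Section Walks.
Context {V : finType}.
Variable E : {set V * V}.

Definition adj (y : int) u v := if y == 1 then (u, v) \in E else (v, u) \in E.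

Fixpoint walks (xs : seq int) (u : V) : seq (seq V) :=
  if xs is y :: xs' then
    flatten [seq [seq v :: w | w <- walks xs' v] | v <- enum V & adj y u v]
  else [:: [::]].

Lemma size_walks_cons y xs u :
  size (walks (y :: xs) u) = (\sum_(v | adj y u v) size (walks xs v))%N.
Proof.
rewrite /= size_flatten /shape -map_comp sumnE big_map big_filter big_enum_cond.
by apply: eq_big => // v _; rewrite /= size_map.
Qed.

(** Edge i of a walk joins entry i of u :: w to entry i of w. *)
Lemma mem_walks d xs u w : size w = size xs ->
  (forall i, (i < size xs)%N -> adj xs`_i (nth d (u :: w) i) (nth d w i)) ->
  w \in walks xs u.
Proof.
elim: xs u w => [|y xs IHxs] u [|v w] //= [sw] adjw.
apply/flattenP; exists [seq v :: w | w <- walks xs v].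
  by apply: map_f; rewrite mem_filter mem_enum (adjw 0%N).
by apply: map_f; apply: IHxs => // i ltix; exact: (adjw i.+1).
Qed.

End Walks.

(** A homomorphism is determined by the walk that it traces. *)
Lemma card_Hom_le_walks (T : oriented_graph) k (x : k.-tuple int) :
  is_sign_vector x ->
  (#|Defs.Hom (oriented_path x) T| <= \sum_u size (walks (edges T) x u))%N.
Proof.
move=> sgn; set H := Defs.Hom _ T.
pose trace (f : {ffun 'I_k.+1 -> vertex T}) := [seq f i | i <- enum 'I_k.+1].
have nth_trace f d (j : 'I_k.+1) : nth d (trace f) j = f j.
  by rewrite (nth_map j) ?size_enum_ord // nth_ord_enum.
have trace_inj : injective trace.
  move=> f g fg; apply/ffunP => j.
  by rewrite -(nth_trace f (f j) j) fg nth_trace.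
pose all_walks := flatten [seq [seq u :: w | w <- walks (edges T) x u]
                          | u <- enum (vertex T)].
have -> : (\sum_u size (walks (edges T) x u))%N = size all_walks.
  rewrite size_flatten /shape -map_comp sumnE big_map big_enum.
  by apply: eq_bigr => u _; rewrite /= size_map.
rewrite cardE -(size_map trace); apply: uniq_leq_size.
  by rewrite map_inj_uniq ?enum_uniq.
move=> _ /mapP[f + ->]; rewrite mem_enum inE => /forallP fH.
apply/flattenP; exists [seq f ord0 :: w | w <- walks (edges T) x (f ord0)].
  by apply: map_f; rewrite mem_enum.
have traceE : trace f = f ord0 :: behead (trace f) by rewrite /trace enum_ordSl.
rewrite traceE; apply: map_f; apply: (mem_walks _ (f ord0)).
  by rewrite size_behead size_map size_enum_ord size_tuple.
rewrite -traceE size_tuple => i ltik; rewrite nth_behead.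
pose o := Ordinal ltik; pose j : 'I_k.+1 := widen_ord (leqnSn k) o.
have -> : nth (f ord0) (trace f) i = f j by exact: nth_trace f _ j.
have -> : nth (f ord0) (trace f) i.+1 = f (lift ord0 o).
  by exact: nth_trace f _ (lift ord0 o).
have xo : tnth x o = x`_i by rewrite (tnth_nth 0).
rewrite /adj; case: ifPn => xi.
  apply: (implyP (forallP (fH j) (lift ord0 o))).
  by rewrite inE; apply/existsP; exists o; rewrite xo xi !eqxx.
apply: (implyP (forallP (fH (lift ord0 o)) j)).
rewrite inE; apply/existsP; exists o; rewrite xo !eqxx !andbT.
by have [] := sgn o; rewrite xo => x1; rewrite x1 ?eqxx ?orbT // in xi *.
Qed.

Lemma card_path_edges_le k (x : k.-tuple int) : (#|path_edges x| <= k)%N.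
Proof.
pose e (i : 'I_k) : 'I_k.+1 * 'I_k.+1 :=
  if tnth x i == 1 then (widen_ord (leqnSn k) i, lift ord0 i)
  else (lift ord0 i, widen_ord (leqnSn k) i).
rewrite -[leqRHS](card_ord k) -cardsT; apply: leq_trans (leq_imset_card e _).
apply/subset_leq_card/subsetP => -[u v]; rewrite inE => /existsP[i /= Hi].
apply/imsetP; exists i => //; rewrite /e.
case/orP: Hi => /and3P[/eqP-> /eqP ui /eqP vi] /=;
  by congr (_, _); apply: val_inj; rewrite /= ?lift0.
Qed.

(** The extreme vertices 0 and k are never flips, so the internal vertex i.+1
    corresponds to the pair of consecutive signs i and i.+1. *)
Lemma flips_direction_flips k (x : k.-tuple int) :
  flips x = #|direction_flips x|.
Proof.
have bump0 i : bump 0 i = i.+1 by [].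
rewrite /flips size_tuple -sum1dep_card [RHS]big_mkcond.
case: k x => [|k] x /=; first by rewrite big_ord0 big_ord_recl big_ord0.
rewrite big_ord_recl big_ord_recr /= !bump0 ltnn addn0 add0n.
apply: eq_bigr => i _; rewrite bump0 ltnS ltn_ord /=.
by case: (_ == _).
Qed.

(** * Long paths with few flips *)

Theorem anti_sidorenko_of_few_flips k (x : k.-tuple int) :
  is_sign_vector x -> (33 * #|direction_flips x| + 8 <= k)%N ->
  anti_sidorenko (oriented_path x).
Proof.
move=> sgn len T [V_gt0 tour].
set V := vertex T in V_gt0 tour *; set n : rat := #|V|%:R.
have n_gt0 : 0 < n by rewrite ltr0n.
have n_ge0 := ltW n_gt0.
pose sigma (u v : V) : rat := ((u, v) \in edges T)%:R - ((v, u) \in edges T)%:R.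
have sigmaN u v : sigma v u = - sigma u v by rewrite /sigma opprB.
have sigma_le1 u v : sigma u v ^+ 2 <= 1.
  by rewrite /sigma; do 2!case: (_ \in _).
(* Off the diagonal this is an equality; on it, sigma and A vanish. *)
have adj_le (y : int) u v : (y == 1) || (y == -1) ->
    2 * (adj (edges T) y u v)%:R <= 1 + y%:~R * sigma u v.
  move=> ysgn; rewrite /adj /sigma; have [<-|uv] := eqVneq u v.
    by rewrite (negbTE (edges_loopless u)) subrr mulr0 addr0 if_same mulr0.
  have := tour u v uv.
  by case/orP: ysgn => /eqP-> /=; do 2!case: (_ \in _).
have walks_le xs u : sign_seq xs ->
    2 ^+ size xs * (size (walks (edges T) xs u))%:R
    <= n ^+ size xs * walk_density sigma xs u.
  elim: xs u => [|y xs IHxs] u; first by rewrite !expr0 !mul1r ffunE.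
  case/andP=> ysgn /IHxs {}IHxs.
  rewrite size_walks_cons natr_sum big_mkcond /=.
  set f := walk_density sigma xs in IHxs *.
  have -> : n ^+ (size xs).+1 * step sigma y%:~R f u =
      \sum_v (1 + y%:~R * sigma u v) * (n ^+ size xs * f v).
    under eq_bigr do rewrite mulrCA mulrDl mul1r -mulrA.
    rewrite -mulr_sumr big_split /= -mulr_sumr exprSr -mulrA; congr (_ * _).
    rewrite !ffunE /dot mulr1 mulrDr; congr (_ + _).
      rewrite (mulrC n) divfK ?gt_eqF //; apply: eq_bigr => v _.
      by rewrite ffunE mul1r.
    by rewrite mulrCA (mulrC n) divfK ?gt_eqF.
  rewrite mulr_sumr; apply: ler_sum => v _.
  have step_le := adj_le y u v ysgn.
  apply: le_trans (_ : 2 * (adj (edges T) y u v)%:R * (n ^+ size xs * f v) <= _).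
    case: (adj _ _ _ _); last by rewrite !mulr0 mul0r.
    by rewrite mulr1 exprS -mulrA ler_wpM2l.
  rewrite ler_wpM2r //; apply: le_trans (IHxs v).
  by rewrite mulr_ge0 ?ler0n ?exprn_ge0.
have xsgn : sign_seq x.
  apply/allP => y /tnthP[i ->].
  by case: (sgn i) => ->.
have mean_le : dot one (walk_density sigma x) <= 1.
  by apply: mean_walk_density_le1 => //; rewrite flips_direction_flips size_tuple.
have hom_le : 2 ^+ k * #|Defs.Hom (oriented_path x) T|%:R <= n ^+ k.+1.
  apply: le_trans (_ : 2 ^+ k * \sum_u (size (walks (edges T) x u))%:R <= _).
    by rewrite ler_wpM2l ?exprn_ge0 // -natr_sum ler_nat card_Hom_le_walks.
  rewrite mulr_sumr; apply: le_trans (_ : \sum_u n ^+ k * walk_density sigma x u <= _).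
    apply: ler_sum => u _.
    by have := walks_le x u xsgn; rewrite size_tuple.
  rewrite -mulr_sumr exprSr ler_wpM2l ?exprn_ge0 //.
  move: mean_le; rewrite /dot ler_pdivrMr // mul1r; apply: le_trans.
  by apply: ler_sum => u _; rewrite ffunE mul1r.
rewrite /hom_density card_ord -/n ler_pdivrMr ?exprn_gt0 //.
apply: le_trans (_ : (1 / 2) ^+ k * n ^+ k.+1 <= _).
  by rewrite mul1r exprVn ler_pdivlMl ?exprn_gt0.
rewrite ler_wpM2r ?exprn_ge0 //.
by apply: ler_wiXn2l => //; exact: card_path_edges_le.
Qed.

Theorem theorem1p3 (R : realType) :
  (exists alpha beta : R,
     0 < alpha /\ 0 < beta /\
     forall (k r : nat), (r < k)%N -> alpha * r%:R + beta <= k%:R ->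
       forall x : k.-tuple int, is_sign_vector x ->
         #|direction_flips x| = r -> anti_sidorenko (oriented_path x)) /\
  (forall (k r : nat), (r < k)%N -> (1665 * r + 1454 <= k)%N ->
     forall x : k.-tuple int, is_sign_vector x ->
       #|direction_flips x| = r -> anti_sidorenko (oriented_path x)).
Proof.
split.
  exists 33, 8; do 2!split=> //.
  move=> k r _; rewrite -natrM -natrD ler_nat => len x sgn xr.
  by apply: anti_sidorenko_of_few_flips => //; rewrite xr.
move=> k r _ len x sgn xr.
by apply: anti_sidorenko_of_few_flips => //; rewrite xr; lia.
Qed.
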